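(* Let $b,s,k>0$ be integers such that $$D=D(b,s,k)=(4bs+1)^k+\bigl(b(4bs+1)^k+s\bigr)^2$$ is squarefree. If $4bs+1$ is not a prime, then $h(D)>1$.
   Context: For a squarefree integer $D>1$, $h(D)$ denotes the class number of the real quadratic field $\mathbb{Q}(\sqrt D)$. *)

(* Defs.v *)
From mathcomp Require Import all_boot all_order all_algebra all_field.
From mathcomp Require Import finmap.
From mathcomp Require Import boolp classical_sets functions cardinality.

Set Implicit Arguments.
Unset Strict Implicit.
Unset Printing Implicit Defensive.

Import Order.TTheory GRing.Theory Num.Theory.

Local Open Scope classical_set_scope.
Local Open Scope ring_scope.

Definition squarefree (n : nat) : Prop :=
  forall d : nat, (d ^ 2 %| n)%N -> d = 1%N.

(* Number fields are subfields of [algC], given by their underlying sets. *)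
Definition quadratic_field (D : nat) : set algC :=
  [set z | exists a b : rat, z = ratr a + ratr b * sqrtC D%:R].

Definition ring_of_integers (K : set algC) : set algC :=
  K `&` [set z | z \in Aint].

Record fractional_ideal (K I : set algC) : Prop := FractionalIdeal {
  fideal_sub : I `<=` K;
  fideal_neq0 : exists2 x, I x & x != 0;
  fideal_add : forall x y, I x -> I y -> I (x + y);
  fideal_mul : forall a x, ring_of_integers K a -> I x -> I (a * x);
  fideal_denom : exists d, [/\ ring_of_integers K d, d != 0 &
    forall x, I x -> ring_of_integers K (d * x)] }.

(* The coset of [I] modulo the principal fractional ideals: multiplying [I] by
   the principal ideal generated by [x] gives [x I]. *)
Definition ideal_class (K I : set algC) : set (set algC) :=
  [set [set x * y | y in I] | x in K `&` [set x | x != 0]].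

Definition class_group (K : set algC) : set (set (set algC)) :=
  [set ideal_class K I | I in [set I | fractional_ideal K I]].

(* [fset_set] is empty on an infinite set, so [(0 < class_number K)%N] includes
   the finiteness of the class group. *)
Definition class_number (K : set algC) : nat :=
  #|` fset_set (class_group K)|.

Definition h (D : nat) : nat := class_number (quadratic_field D).

Definition D_ (b s k : nat) : nat :=
  ((4 * b * s + 1) ^ k + (b * (4 * b * s + 1) ^ k + s) ^ 2)%N.

(* Main.v *)
(* Put n = 4bs+1 and N = n^k, so that D = (bN+s)^2 + N = (bN-s)^2 + nN.  The
   continued fraction of sqrt D is then explicit, and all denominators Q_i of its
   complete quotients are powers of n; hence |x^2 - D y^2| <= bN+s < sqrt D forces
   |x^2 - D y^2| = g^2 n^e.  Let p be the smallest prime factor of n.  As p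
   divides N, (bN+s)^2 = D mod p, and the ideal (p, bN+s+sqrt D) has norm p.  A
   generator would yield x^2 - D y^2 = +-4p, which is not of the form g^2 n^e
   unless n = p; the bound 4p <= bN+s fails only for D = 130, where x and y have
   to be even.  The finiteness of the class group follows Hurwitz: for z in
   Q(sqrt D), some multiple t z with 1 <= t <= D differs from an element of
   Z[sqrt D] by an element of norm less than 1 in absolute value. *)
Require Import Defs.
From mathcomp Require Import all_boot all_order all_algebra all_field.
From mathcomp Require Import finmap.
From mathcomp Require Import boolp classical_sets functions cardinality.
From mathcomp Require Import zify ring lra.

Set Implicit Arguments.
Unset Strict Implicit.
Unset Printing Implicit Defensive.

Import Order.TTheory GRing.Theory Num.Theory.

Local Open Scope classical_set_scope.
Local Open Scope ring_scope.

(** * Small values of the norm form *)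

(* Its discriminant is [4 * (p ^+ 2 + q * r)]; with [p ^+ 2 + q * r = D] and
   [q], [p], [r] positive it encodes the complete quotient [(p + sqrt D) / q]. *)
Definition bform (q p r x y : int) : int :=
  q * x ^+ 2 - p * x * y *+ 2 - r * y ^+ 2.

(** A continued fraction step: if p^2 + q r = D, then removing the partial quotient a from (p + sqrt
    D) / q and inverting gives (p' + sqrt D) / r' with p' = q a - p and D = p'^2 + q r'. *)
Lemma bform_step (q p r a z y : int) :
  bform q p r (a * y + z) y
  = - bform (r + p * a *+ 2 - q * a ^+ 2) (q * a - p) q y z.
Proof. rewrite /bform; ring. Qed.

(* [- bform q p r] is concave in its first variable, so its minimum over
   [1 <= x <= a * y - 1] is attained at an end point. *)
Lemma bform_large (q p r a l x y : int) :
  0 <= q -> 0 <= p -> 0 <= r -> p <= q * a ->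
  0 <= r + p * a *+ 2 - q * a ^+ 2 ->
  l < r + p *+ 2 - q ->
  l < (r + p * a *+ 2 - q * a ^+ 2) + (q * a - p) *+ 2 - q ->
  0 < x -> 0 < y -> x < a * y -> l < - bform q p r x y.
Proof.
move=> q0 p0 r0 p1 r1 l0 l1 x0 y0 xay.
have F1 : l < - bform q p r 1 y.
  apply: (lt_le_trans l0); rewrite /bform; nia.
have F2 : l < - bform q p r (a * y - 1) y.
  apply: (lt_le_trans l1); rewrite bform_step opprK /bform; nia.
have [ay1|ay1] := eqVneq (a * y) 2.
  by have -> : x = 1 by lia.
have t0 : 0 < a * y - 2 by lia.
(* The value at x against the chord through the two end points; the last term is the excess due to
   concavity. *)
have E : (a * y - 2) * (- bform q p r x y - l) =
  (a * y - 1 - x) * (- bform q p r 1 y - l)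
  + (x - 1) * (- bform q p r (a * y - 1) y - l)
  + q * ((a * y - 2) * ((x - 1) * (a * y - 1 - x))).
  rewrite /bform; ring.
rewrite -subr_gt0 -(pmulr_rgt0 _ t0) E.
have h1 : 0 <= a * y - 1 - x by lia.
have h2 : 0 <= x - 1 by lia.
have h3 : 0 <= q * ((a * y - 2) * ((x - 1) * (a * y - 1 - x))).
  by rewrite mulr_ge0// mulr_ge0 ?mulr_ge0//; lia.
have : 0 < (a * y - 1 - x) + (x - 1) by lia.
move: F1 F2; rewrite -!(subr_gt0 l).
set A := - _ - l; set B := - _ - l => A0 B0 h.
apply: ltr_wpDr => //.
have [x1|x1] := eqVneq x 1.
  by rewrite x1 subrr mul0r addr0 mulr_gt0//; lia.
by apply: ltr_wpDl; [rewrite mulr_ge0// ltW | rewrite mulr_gt0//; lia].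
Qed.


(** By [bform_large] a small value forces x >= a y, so z = x - a y gives a smaller pair with the
    same value up to sign. *)
Lemma bform_reduce (q p r a l r' p' x y : int) :
  r' = r + p * a *+ 2 - q * a ^+ 2 -> p' = q * a - p ->
  0 <= q -> 0 <= p -> 0 <= r -> 0 <= p' -> 0 <= r' -> 0 < a ->
  l < r + p *+ 2 - q -> l < r' + p' *+ 2 - q ->
  0 <= x -> 0 <= y -> `|bform q p r x y| <= l ->
  [\/ x = 0, y = 0 |
    exists z, [/\ 0 <= z, y + z < x + y &
      bform q p r x y = - bform r' p' q y z]].
Proof.
move=> -> -> q0 p0 r0 p1 r1 a0 l0 l1 x0 y0 le_l.
have [->|xN0] := eqVneq x 0; first by constructor 1.
have [->|yN0] := eqVneq y 0; first by constructor 2.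
constructor 3; exists (x - a * y).
have [xay|ayx] := ltP x (a * y).
  have := @bform_large q p r a l x y q0 p0 r0 _ r1 l0 l1 _ _ xay.
  by move=> h; have := h ltac:(lia) ltac:(lia) ltac:(lia); lia.
split; [by rewrite subr_ge0 | nia |].
by rewrite -bform_step addrC subrK.
Qed.

Section Descent.
Variables (b s : int) (n k : nat).
Hypotheses (b_gt0 : 0 < b) (s_gt0 : 0 < s) (nE : n%:Z = b * s *+ 4 + 1).

Let N : int := n%:Z ^+ k.

Let isPow (z : int) : Prop := exists g e : nat, `|z|%N = (g ^ 2 * n ^ e)%N.

Let isPowN z : isPow z -> isPow (- z).
Proof. by move=> [g [e ze]]; exists g, e; rewrite abszN. Qed.

(* The forms are those of the complete quotients of [sqrt D], whose partial
   quotients are [2 b n^j], [2 b n^(i-1)] in turn and [2 (b n^k + s)] at the end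
   of the period ([i = 0]). *)
Lemma bform_descent (m : nat) (i j : nat) (x y : int) :
  (i + j)%N = k -> 0 <= x -> 0 <= y -> x + y < m%:Z ->
  (`|bform (n%:Z ^+ i) (b * N + s) (n%:Z ^+ j) x y| <= b * N + s ->
   isPow (bform (n%:Z ^+ i) (b * N + s) (n%:Z ^+ j) x y)) /\
  ((0 < i)%N ->
   `|bform (n%:Z ^+ j.+1) (b * N - s) (n%:Z ^+ i) x y| <= b * N + s ->
   isPow (bform (n%:Z ^+ j.+1) (b * N - s) (n%:Z ^+ i) x y)).
Proof.
have pow0 (i' j' : nat) p y' : isPow (bform (n%:Z ^+ i') p (n%:Z ^+ j') 0 y').
  have -> : bform (n%:Z ^+ i') p (n%:Z ^+ j') 0 y' = - (n%:Z ^+ j' * y' ^+ 2).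
    by rewrite /bform; ring.
  by exists `|y'|%N, j'; rewrite abszN abszM abszX absz_nat abszX mulnC.
have pow1 (i' j' : nat) p x' : isPow (bform (n%:Z ^+ i') p (n%:Z ^+ j') x' 0).
  have -> : bform (n%:Z ^+ i') p (n%:Z ^+ j') x' 0 = n%:Z ^+ i' * x' ^+ 2.
    by rewrite /bform; ring.
  by exists `|x'|%N, i'; rewrite abszM abszX absz_nat abszX mulnC.
have n5 : 5 <= n%:Z by nia.
have npow e : 1 <= n%:Z ^+ e by apply: exprn_ege1; lia.
elim: m i j x y => [|m IH] i j x y; first by lia.
move=> ijk x0 y0 xym; set I := n%:Z ^+ i; set J := n%:Z ^+ j.
have NIJ : N = I * J by rewrite /N -ijk exprD.
have I1 : 1 <= I := npow i. have J1 : 1 <= J := npow j.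
(* These comparisons feed the end point bounds of [bform_reduce] for l = b N + s. *)
have JN : J <= N by nia. have IN : I <= N by nia.
have bN : N <= b * N by nia.
split.
  case: i ijk @I NIJ I1 IN => [|i] ijk I NIJ I1 IN.
    have I1' : I = 1 by [].
    move=> le_l.
    have := @bform_reduce I (b * N + s) J (b * N *+ 2 + s *+ 2) (b * N + s)
      N (b * N + s) x y.
    case=> //; try nia.
    - by move=> ->; exact: pow0.
    - by move=> ->; exact: pow1.
    move=> [z [z0 zxy E]]; rewrite E; apply: isPowN.
    have [H _] := IH k 0%N y z (addn0 k) y0 z0 ltac:(lia).
    by apply: H; move: le_l; rewrite E normrN.
  move=> le_l.
  have IE : I = n%:Z ^+ i * n%:Z by rewrite /I exprSr.
  (* For a = 2 b J the new coefficient is (1 + 4 b s) J = n J. *)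
  have := @bform_reduce I (b * N + s) J (b * J *+ 2) (b * N + s)
    (n%:Z * J) (b * N - s) x y.
  case=> //; try nia.
  - by move=> ->; exact: pow0.
  - by move=> ->; exact: pow1.
  move=> [z [z0 zxy E]]; rewrite E; apply: isPowN.
  have [_ H] := IH i.+1 j y z ijk y0 z0 ltac:(lia).
  by rewrite -exprS; apply: H => //; move: le_l; rewrite E normrN -exprS.
case: i ijk @I NIJ I1 IN => [|i] //  ijk I NIJ I1 IN _ le_l.
have IE : I = n%:Z * n%:Z ^+ i by rewrite /I exprS.
set I' := n%:Z ^+ i in IE. have I1'' : 1 <= I' := npow i.
have JE : n%:Z ^+ j.+1 = n%:Z * J by rewrite exprS.
(* Here r' = (n - 4 b s) I' = I': one power of n has moved from i to j. *)
have := @bform_reduce (n%:Z ^+ j.+1) (b * N - s) I (b * I' *+ 2)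
  (b * N + s) I' (b * N + s) x y.
move: le_l; rewrite JE => le_l; case=> //; try nia.
- by move=> ->; rewrite -JE; exact: pow0.
- by move=> ->; rewrite -JE; exact: pow1.
move=> [z [z0 zxy E]]; rewrite E; apply: isPowN.
have [H _] := IH i j.+1 y z ltac:(lia) y0 z0 ltac:(lia).
by rewrite -JE; apply: H => //; move: le_l; rewrite E normrN -JE.
Qed.

End Descent.

(** With B = b n^k + s, D = B^2 + n^k and X = |x| + B |y|, the norm is X^2 - 2 B X |y| - n^k y^2,
    which is the form of [bform_descent] at i = 0. *)
Lemma small_norm (b s n k : nat) (x y : int) :
  (0 < b)%N -> (0 < s)%N -> n = (4 * b * s + 1)%N ->
  (`|(x ^+ 2 - (D_ b s k)%:Z * y ^+ 2)%R| <= b * n ^ k + s)%N ->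
  exists g e : nat, `|(x ^+ 2 - (D_ b s k)%:Z * y ^+ 2)%R|%N =
    (g ^ 2 * n ^ e)%N.
Proof.
move=> b0 s0 nE; rewrite /D_ -nE.
have PX m e : (m ^ e)%N%:Z = m%:Z ^+ e by rewrite -[LHS]natz natrX natz.
pose B : int := b%:Z * n%:Z ^+ k + s%:Z.
have BE : (b * n ^ k + s)%N%:Z = B by rewrite PoszD PoszM PX.
pose X := `|x| + B * `|y|.
have nE' : n%:Z = b%:Z * s%:Z *+ 4 + 1 by rewrite nE; lia.
have B0 : 0 <= B by rewrite -BE.
have -> : x ^+ 2 - (n ^ k + (b * n ^ k + s) ^ 2)%N%:Z * y ^+ 2 =
  bform (n%:Z ^+ 0) B (n%:Z ^+ k) X `|y|.
  rewrite /bform /X -[x ^+ 2]real_normK ?num_real//.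
  rewrite -[y ^+ 2]real_normK ?num_real//.
  rewrite PoszD !PX BE.
  ring.
rewrite -lez_nat BE => le_l.
have b0' : 0 < b%:Z by lia.
have s0' : 0 < s%:Z by lia.
have X0 : 0 <= X by rewrite addr_ge0 ?mulr_ge0 ?normr_ge0.
have [H _] := @bform_descent b s n k b0' s0' nE' (absz (X + `|y|)).+1 0 k X `|y|
  (add0n k) X0 (normr_ge0 _) ltac:(lia).
exact: H.
Qed.

(** If e = 0, the valuation at p is 1 on the left and even on the right; if e > 0, n divides c p and
    is prime to c, so n = p. *)
Lemma sqr_pow_neq (n p c g e : nat) :
  odd n -> ~~ prime n -> (1 < n)%N -> (p %| n)%N -> prime p ->
  (c == 1)%N || (c == 4)%N -> (c * p <> g ^ 2 * n ^ e)%N.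
Proof.
move=> on npr n1 pn pp cE; have p3 : odd p by apply: dvdn_odd on.
have c0 : (0 < c)%N by case/orP: cE => /eqP->.
case: e => [|e] E.
  have : logn p (c * p)%N = logn p (g ^ 2 * n ^ 0)%N by rewrite E.
  rewrite expn0 muln1 lognX lognM ?(prime_gt0 pp)// (logn_prime p pp) eqxx.
  have -> : logn p c = 0%N.
    rewrite logn_coprime//; case/orP: cE => /eqP->; first by rewrite coprimen1.
    by rewrite (@coprime_pexpr 2 p 2)// coprimen2.
  by lia.
have : (n %| c * p)%N by rewrite E (expnS n) mulnCA dvdn_mulr.
rewrite Gauss_dvdr; last first.
  case/orP: cE => /eqP->; first by rewrite coprimen1.
  by rewrite (@coprime_pexpr 2 n 2)// coprimen2.
move=> np; have np' : n = p by apply/eqP; rewrite eqn_dvd np pn.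
by move: npr; rewrite np' pp.
Qed.

Lemma norm_neq_pdiv (b s n k : nat) (x y : int) :
  (0 < b)%N -> (0 < s)%N -> (0 < k)%N -> n = (4 * b * s + 1)%N -> ~~ prime n ->
  `|(x ^+ 2 - (D_ b s k)%:Z * y ^+ 2)%R|%N <> (4 * pdiv n)%N.
Proof.
move=> b0 s0 k0 nE npr E.
have n5 : (4 < n)%N by nia.
have n1 : (1 < n)%N by lia.
have on : odd n by lia.
have pp := pdiv_prime n1; have pn := pdiv_dvd n.
have nN : (n <= n ^ k)%N by rewrite -{1}(expn1 n) leq_pexp2l//; lia.
have ppn : (pdiv n ^ 2 <= n)%N.
  by rewrite leqNgt; apply: contra npr; apply: ltn_pdiv2_prime; lia.
have op : odd (pdiv n) by apply: dvdn_odd pn on.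
have np c z t : (c == 1)%N || (c == 4)%N ->
    `|(z ^+ 2 - (D_ b s k)%:Z * t ^+ 2)%R|%N = (c * pdiv n)%N ->
    (c * pdiv n <= b * n ^ k + s)%N -> False.
  move=> c14 Ec le.
  have := @small_norm b s n k z t b0 s0 nE; rewrite Ec => /(_ le)[g [e]].
  exact: sqr_pow_neq.
have [le|lt] := leqP (4 * pdiv n) (b * n ^ k + s); first exact: np E le.
have p3 : (2 < pdiv n)%N.
  by have := prime_gt1 pp; move: op; case: (pdiv n) => [|[|[|]]].
(* Write n = m p: n < 4 p gives m < 4, while p^2 <= n gives m >= p >= 3. *)
have n9 : n = 9%N.
  case/dvdnP: pn => m nm; nia.
have p9 : pdiv n = 3%N by rewrite n9.
have k1 : k = 1%N.
  case: k k0 lt {E nN np} => [|[|k]]// _.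
  rewrite n9 !expnS; have : (0 < 9 ^ k)%N by rewrite expn_gt0.
  by rewrite (_ : pdiv 9 = 3%N)//; nia.
have [b1 s2] : b = 1%N /\ s = 2%N.
  by move: lt; rewrite p9 k1 n9; nia.
move: E np; rewrite p9 /D_ -nE k1 n9 b1 s2 => E np.
(* As 130 is 2 mod 4, the norm +-12 forces x, then y, to be even; the halved pair has norm +-3,
   within the bound 11. *)
have [x' xE] : exists x', x = x' *+ 2 by exists (x %/ 2)%Z; nia.
have [y' yE] : exists y', y = y' *+ 2 by exists (y %/ 2)%Z; nia.
apply: (np 1%N x' y') => //; move: E; rewrite xE yE; lia.
Qed.

(** * Arithmetic of the quadratic field *)

(** For v = a / d in lowest terms, d^2 divides D a^2, hence D. *)
Lemma int_num_sqr_rat (D : nat) (v : rat) :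
  squarefree D -> D%:R * v ^+ 2 \in Num.int -> v \in Num.int.
Proof.
move=> sD /intrP[m Dv].
have E : D%:Z * numq v ^+ 2 = m * denq v ^+ 2.
  apply: (@intr_inj rat); rewrite !expr2 !rmorphM/= -Dv.
  rewrite -{3}(divq_num_den v).
  have := denq_neq0 v; rewrite -(intr_eq0 rat) => d0.
  by field.
have : (`|denq v| ^ 2 %| D * `|numq v| ^ 2)%N.
  apply/dvdnP; exists `|m|%N; move/(congr1 absz): E.
  by rewrite !expr2 !abszM /= !mulnn.
rewrite Gauss_dvdl; last first.
  by rewrite coprimeXl ?coprimeXr// coprime_sym coprime_num_den.
by move=> /sD d1; rewrite Qint_def; apply/eqP; have := denq_gt0 v; lia.
Qed.

(** Rational coordinates keep norms in the ordered field [rat] and make conjugation the sign change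
    of b. *)
Definition qel (D : nat) (a b : rat) : algC := ratr a + ratr b * sqrtC D%:R.
Definition qnorm (D : nat) (a b : rat) : rat := a ^+ 2 - D%:R * b ^+ 2.

Lemma qelD D a b c d : qel D a b + qel D c d = qel D (a + c) (b + d).
Proof. by rewrite /qel !rmorphD /=; ring. Qed.

Lemma qelN D a b : - qel D a b = qel D (- a) (- b).
Proof. by rewrite /qel !rmorphN /=; ring. Qed.

Lemma qelM D a b c d :
  qel D a b * qel D c d = qel D (a * c + D%:R * (b * d)) (a * d + b * c).
Proof.
rewrite /qel !rmorphD /= !rmorphM /= ratr_nat.
by have := sqrtCK (D%:R : algC); move: (sqrtC _) => w <-; ring.
Qed.

Lemma qel0r D a : qel D a 0 = ratr a.
Proof. by rewrite /qel rmorph0 mul0r addr0. Qed.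

Lemma qelMconj D a b : qel D a b * qel D a (- b) = ratr (qnorm D a b).
Proof.
rewrite qelM -(qel0r D) /qnorm; congr (qel D _ _); ring.
Qed.

Lemma qnormM D a b c d :
  qnorm D (a * c + D%:R * (b * d)) (a * d + b * c) = qnorm D a b * qnorm D c d.
Proof. rewrite /qnorm; ring. Qed.

Lemma qnorm_eq0 D a b :
  squarefree D -> (1 < D)%N -> qnorm D a b = 0 -> a = 0 /\ b = 0.
Proof.
move=> sD D1 /eqP; rewrite subr_eq0 => /eqP ab.
have [b0|bN0] := eqVneq b 0.
  by move: ab; rewrite b0 expr0n mulr0 => /eqP; rewrite sqrf_eq0 => /eqP.
have E : (a / b) ^+ 2 = D%:R by rewrite expr_div_n ab mulfK// expf_neq0.
have : a / b \in Num.int.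
  (* With 1 in place of D: a rational number whose square is an integer is itself an integer. *)
  apply: (@int_num_sqr_rat 1); last by rewrite mul1r E; apply/intrP; exists D.
  move=> d; rewrite dvdn1 => /eqP; nia.
move=> /intrP[m mE].
have : (`|m| ^ 2)%N = D.
  apply/eqP; rewrite -(eqr_nat rat) -E mE natrX natr_absz intr_norm.
  by rewrite real_normK ?num_real.
move=> mD; move: (sD `|m|%N); rewrite mD dvdnn => /(_ isT) m1.
by move: D1; rewrite -mD m1.
Qed.

Lemma qel_eq0 D a b :
  squarefree D -> (1 < D)%N -> qel D a b = 0 -> a = 0 /\ b = 0.
Proof.
move=> sD D1 ab0; apply: (qnorm_eq0 sD D1); apply/eqP.
have := qelMconj D a b; rewrite ab0 mul0r => /esym/eqP.
by rewrite fmorph_eq0 => /eqP ->.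
Qed.

Lemma qel_inj D a b c d :
  squarefree D -> (1 < D)%N -> qel D a b = qel D c d -> a = c /\ b = d.
Proof.
move=> sD D1 /eqP; rewrite -subr_eq0 qelN qelD => /eqP/qel_eq0.
by move=> /(_ sD D1)[/eqP + /eqP]; rewrite !subr_eq0 => /eqP-> /eqP->.
Qed.

(** Replaces the automorphism sending sqrt D to - sqrt D: rational polynomials take conjugate values
    at conjugate points. *)
Lemma qel_horner_conj D a b (p : {poly rat}) : exists c d,
  (map_poly ratr p).[qel D a b] = qel D c d /\
  (map_poly ratr p).[qel D a (- b)] = qel D c (- d).
Proof.
elim/poly_ind: p => [|p r [c [d [E1 E2]]]].
  by exists 0, 0; rewrite rmorph0 !horner0 oppr0 /qel rmorph0 mul0r addr0.
exists (c * a + D%:R * (d * b) + r), (c * b + d * a).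
have hE z : (map_poly ratr (p * 'X + r%:P)).[z] =
    (map_poly ratr p).[z] * z + ratr r :> algC.
  rewrite rmorphD rmorphM /= map_polyX map_polyC.
  by rewrite hornerD hornerM hornerX hornerC.
by rewrite !hE E1 E2 !qelM -(qel0r D) !qelD; split; congr (qel D _ _); ring.
Qed.

(** The conjugate is a root of the same monic integral minimal polynomial. *)
Lemma qel_conj_Aint D a b : squarefree D -> (1 < D)%N ->
  qel D a b \in Aint -> qel D a (- b) \in Aint.
Proof.
move=> sD D1 zA.
have [p [pE pm] pd] := minCpolyP (qel D a b).
apply: (@root_monic_Aint (minCpoly (qel D a b))).
- have [c [d [E1 E2]]] := qel_horner_conj D a b p.
  have := root_minCpoly (qel D a b); rewrite pE !rootE E1 E2 => /eqP/qel_eq0.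
  by move=> /(_ sD D1)[-> ->]; rewrite oppr0 qel0r rmorph0.
- exact: minCpoly_monic.
- exact: zA.
Qed.

Lemma ratr_Aint (a : rat) : ratr a \in Aint -> a \in Num.int.
Proof.
by move=> aA; rewrite -Cint_rat; apply: Cint_rat_Aint => //; apply: Crat_rat.
Qed.

(** Trace and norm are rational algebraic integers, and D (2b)^2 = (2a)^2 - 4 N then makes 2b
    integral. *)
Lemma qel_Aint D a b : squarefree D -> (1 < D)%N -> qel D a b \in Aint ->
  [/\ a *+ 2 \in Num.int, b *+ 2 \in Num.int & qnorm D a b \in Num.int].
Proof.
move=> sD D1 zA; have zA' := qel_conj_Aint sD D1 zA.
have a2 : a *+ 2 \in Num.int.
  apply: ratr_Aint.
  have -> : ratr (a *+ 2) = qel D a b + qel D a (- b) :> algC.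
    by rewrite qelD subrr qel0r.
  exact: rpredD.
have nZ : qnorm D a b \in Num.int.
  by apply: ratr_Aint; rewrite -qelMconj rpredM.
split=> //; apply: (int_num_sqr_rat sD).
have -> : D%:R * (b *+ 2) ^+ 2 = (a *+ 2) ^+ 2 - qnorm D a b *+ 4.
  by rewrite /qnorm; ring.
by apply: rpredB; [exact: rpredX | exact: rpredMn].
Qed.

Lemma sqrtC_nat_Aint (D : nat) : sqrtC D%:R \in Aint.
Proof.
apply: (@root_monic_Aint ('X^2 - D%:R%:P)).
- by rewrite rootE !hornerE sqrtCK subrr.
- exact: monicXnsubC.
- by rewrite polyOverXnsubC rpred_nat.
Qed.

Lemma qel_int_Aint D (i j : int) : qel D i%:~R j%:~R \in Aint.
Proof.
rewrite /qel !ratr_int; apply: rpredD; first exact: Aint_int.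
by apply: rpredM; [exact: Aint_int | exact: sqrtC_nat_Aint].
Qed.

(** * Finiteness of the class group *)

(** Pigeonhole: the fractional parts of i b for 0 <= i <= m fall into m intervals of length 1/m. *)
Lemma dirichlet_approx (m : nat) (b : rat) : (0 < m)%N ->
  exists t : nat, exists u : int, [/\ (0 < t)%N, (t <= m)%N &
    `|t%:R * b - u%:~R| * m%:R < 1].
Proof.
move=> m0; have mR : 0 < m%:R :> rat by rewrite ltr0n.
pose r (i : nat) : rat := i%:R * b - (Num.floor (i%:R * b))%:~R.
have r0 i : 0 <= r i by rewrite subr_ge0 floor_le.
have r1 i : r i < 1.
  by rewrite ltrBlDr addrC -[X in _ + X]/(1%:~R) -intrD floorD1_gt.
have rm0 i : 0 <= r i * m%:R by rewrite mulr_ge0// ltW.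
have rm i : (Num.truncn (r i * m%:R) < m)%N.
  by rewrite truncn_lt_nat// gtr_pMl.
pose f (i : 'I_m.+1) : 'I_m := Ordinal (rm i).
have /injectivePn[i [j ij fij]] : ~~ injectiveb f.
  by apply/injectiveP => /leq_card; rewrite !card_ord ltnn.
wlog lt_ij : i j ij fij / (i < j)%N.
  move=> H; have [lt|lt|eq] := ltngtP i j; first exact: (H i j).
    by apply: (H j i) => //; rewrite eq_sym.
  by move: ij; rewrite (val_inj eq) eqxx.
exists (j - i)%N, (Num.floor (j%:R * b) - Num.floor (i%:R * b)); split.
- by rewrite subn_gt0.
- by have := ltn_ord j; lia.
have -> : (j - i)%:R * b - (Num.floor (j%:R * b) - Num.floor (i%:R * b))%:~R
    = r j - r i.
  by rewrite natrB 1?ltnW// intrB /r; ring.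
have /andP[i1 i2] := truncn_itv (rm0 i).
have /andP[j1 j2] := truncn_itv (rm0 j).
move/(congr1 val): fij => /= fij; rewrite -fij in j1 j2.
move: i2 j2; rewrite -natr1 => i2 j2.
rewrite -[X in _ * X](gtr0_norm mR) -normrM mulrBl ltr_norml.
by apply/andP; split; lra.
Qed.

(** Dirichlet with m = D gives D |y| < 1, so x^2 and D y^2 both lie in [0, 1) once x is a fractional
    part. *)
Lemma sub_lattice_norm_lt1 (D : nat) (a b : rat) : (0 < D)%N ->
  exists t : nat, exists u v : int, [/\ (0 < t)%N, (t <= D)%N &
    `|qnorm D (t%:R * a - u%:~R) (t%:R * b - v%:~R)| < 1].
Proof.
move=> D0; have [t [v [t0 tD tv]]] := dirichlet_approx b D0.
exists t, (Num.floor (t%:R * a)), v; split => //.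
set x := _ - _; set y := _ - _.
have x0 : 0 <= x by rewrite subr_ge0 floor_le.
have x1 : x < 1.
  by rewrite ltrBlDr addrC -[X in _ + X]/(1%:~R) -intrD floorD1_gt.
have D1 : 1 <= D%:R :> rat by rewrite ler1n.
have y0 : 0 <= D%:R * y ^+ 2.
  by rewrite mulr_ge0 ?sqr_ge0// ltW// (lt_le_trans ltr01).
have y1 : D%:R * y ^+ 2 < 1.
  rewrite -(real_normK (num_real y)).
  have := normr_ge0 y; have : `|y| * D%:R < 1 by [].
  set z := `|y|; move: (D%:R : rat) D1 => d d1 zd z0; nra.
rewrite /qnorm ltr_norml; apply/andP; split; nra.
Qed.


Lemma quadratic_fieldM D x y :
  quadratic_field D x -> quadratic_field D y -> quadratic_field D (x * y).
Proof. by move=> [a [b ->]] [c [d ->]]; rewrite [_ * _]qelM; do 2 eexists. Qed.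

Lemma quadratic_fieldD D x y :
  quadratic_field D x -> quadratic_field D y -> quadratic_field D (x + y).
Proof. by move=> [a [b ->]] [c [d ->]]; rewrite [_ + _]qelD; do 2 eexists. Qed.

Lemma qel_quadratic_field D a b : quadratic_field D (qel D a b).
Proof. by exists a, b. Qed.

Lemma quadratic_fieldV D x : squarefree D -> (1 < D)%N ->
  quadratic_field D x -> quadratic_field D x^-1.
Proof.
move=> sD D1 [a [b ->]]; rewrite -/(qel D a b).
(* The conjugate vanishes only for the element 0, whose inverse is 0 by convention. *)
have [x0|x0] := eqVneq (qel D a (- b)) 0.
  have [-> /eqP] := qel_eq0 sD D1 x0; rewrite oppr_eq0 => /eqP ->.
  have E0 : qel D 0 0 = 0 by rewrite qel0r rmorph0.
  by rewrite E0 invr0 -E0; apply: qel_quadratic_field.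
have -> : (qel D a b)^-1 = qel D (qnorm D a b)^-1 0 * qel D a (- b).
  by rewrite qel0r fmorphV /= -qelMconj invfM -mulrA mulVf// mulr1.
by apply: quadratic_fieldM; apply: qel_quadratic_field.
Qed.

Local Notation OK D := (ring_of_integers (quadratic_field D)).

Lemma qel_int_OK D (i j : int) : OK D (qel D i%:~R j%:~R).
Proof. by split; [exact: qel_quadratic_field | exact: qel_int_Aint]. Qed.

Lemma OK_nat D (m : nat) : OK D m%:R.
Proof.
have -> : m%:R = qel D m%:Z%:~R 0%:~R by rewrite qel0r rmorph_nat.
exact: qel_int_OK.
Qed.

Lemma OK_mul D x y : OK D x -> OK D y -> OK D (x * y).
Proof.
move=> [kx ax] [ky ay]; split; first exact: quadratic_fieldM.
exact: rpredM.
Qed.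

Lemma OK_add D x y : OK D x -> OK D y -> OK D (x + y).
Proof.
move=> [kx ax] [ky ay]; split; first exact: quadratic_fieldD.
exact: rpredD.
Qed.

Lemma OK_fractional_ideal D : fractional_ideal (quadratic_field D) (OK D).
Proof.
split.
- by move=> x [].
- by exists 1; [exact: (OK_nat D 1) | exact: oner_neq0].
- by move=> x y; apply: OK_add.
- by move=> x y; apply: OK_mul.
- exists 1; split; [exact: (OK_nat D 1) | exact: oner_neq0 |].
  by move=> x; rewrite mul1r.
Qed.

Lemma ideal_class_scale D (I : set algC) x : squarefree D -> (1 < D)%N ->
  quadratic_field D x -> x != 0 ->
  ideal_class (quadratic_field D) [set x * y | y in I] =
  ideal_class (quadratic_field D) I.
Proof.
move=> sD D1 kx x0; rewrite /ideal_class; apply/seteqP.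
split=> [_ [y [ky y0] <-]|_ [y [ky y0] <-]].
  exists (y * x).
    by split; [exact: quadratic_fieldM | rewrite /= mulf_neq0].
  by rewrite image_comp; apply: eq_imagel => z _ /=; rewrite mulrA.
exists (y / x).
  split; first by apply: quadratic_fieldM => //; apply: quadratic_fieldV.
  by rewrite /= mulf_neq0// invr_neq0.
by rewrite image_comp; apply: eq_imagel => z _ /=; rewrite mulrA divfK.
Qed.

(* [beta] has minimal norm in [I]: if some [t <= D] and some lattice point [w]
   satisfy [|N(t (x / beta) - w)| < 1], then [t x - w beta], an element of [I]
   of smaller norm than [beta], vanishes. *)
Lemma fractional_ideal_reduced D (I : set algC) : squarefree D -> (1 < D)%N ->
  fractional_ideal (quadratic_field D) I ->
  exists beta, [/\ I beta, beta != 0 &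
    forall x, I x -> OK D (D`!%:R * (x / beta))].
Proof.
move=> sD D1 [IK [x0 Ix0 x0N] IA IM [d [Od d0 dI]]].
(* Scaling by the denominator d makes the absolute norms natural numbers, so a minimum exists. *)
pose P (m : nat) := exists y a b, [/\ I y, y != 0, d * y = qel D a b &
  `|qnorm D a b| = m%:R].
have norm_nat y : I y ->
    exists a b m, d * y = qel D a b /\ `|qnorm D a b| = m%:R.
  move=> /dI[[a [b E]] A]; have : qel D a b \in Aint by rewrite /qel -E.
  move=> /(qel_Aint sD D1)[_ _ /intrP[m mE]]; exists a, b, `|m|%N; split=> //.
  by rewrite mE natr_absz intr_norm.
have exP : exists m, `[< P m >].
  have [a [b [m [E1 E2]]]] := norm_nat _ Ix0.
  by exists m; apply/asboolP; exists x0, a, b.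
case: (ex_minnP exP) => m /asboolP[beta [a [b [Ib b0 bE bN]]]] mmin.
exists beta; split=> // x Ix.
have [p [q xE]] : quadratic_field D (x / beta).
  apply: quadratic_fieldM; first exact: IK.
  by apply: quadratic_fieldV => //; exact: IK.
rewrite -/(qel D p q) in xE.
have [t [u [v [t0 tD tuv]]]] := sub_lattice_norm_lt1 p q (ltnW D1).
pose y := t%:R * x + - qel D u%:~R v%:~R * beta.
have Iy : I y.
  apply: IA; apply: IM => //; first exact: OK_nat.
  by rewrite qelN -!intrN; apply: qel_int_OK.
set p' := t%:R * p - _ in tuv; set q' := t%:R * q - _ in tuv.
have zE : t%:R * (x / beta) - qel D u%:~R v%:~R = qel D p' q'.
  have -> : t%:R = qel D t%:R 0 by rewrite qel0r ratr_nat.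
  by rewrite xE qelM qelN qelD /p' /q'; congr (qel D _ _); ring.
have yE : y = beta * qel D p' q'.
  by rewrite -zE /y; field.
have [y0|y0] := eqVneq y 0.
  have : beta * qel D p' q' == 0 by rewrite -yE y0.
  rewrite mulf_eq0 (negPf b0) /= -zE subr_eq0 => /eqP tx.
  have /dvdnP[c cE] : (t %| D`!)%N by rewrite dvdn_fact// t0.
  rewrite cE natrM -mulrA tx; apply: OK_mul; first exact: OK_nat.
  exact: qel_int_OK.
have [a' [b' [m' [E1 E2]]]] := norm_nat _ Iy.
have /mmin : `[< P m' >] by apply/asboolP; exists y, a', b'.
rewrite -(ler_nat rat) -E2 -bN.
move: E1; rewrite yE mulrA bE qelM => /(qel_inj sD D1)[<- <-].
(* |N(d y)| is |N(d beta)| times a factor below 1, against minimality. *)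
rewrite qnormM normrM leNgt => /negP[]; rewrite gtr_pMr// normr_gt0.
apply/eqP => /(qnorm_eq0 sD D1)[a0 b00].
by move: (mulf_neq0 d0 b0); rewrite bE a0 b00 qel0r rmorph0 eqxx.
Qed.

(* Up to principal ideals, [Z[sqrt D] <= I <= Z[sqrt D] / M] with [M] depending
   only on [D], so [I] is determined by finitely many residues modulo [M]. *)
Lemma finite_class_group D : squarefree D -> (1 < D)%N ->
  finite_set (class_group (quadratic_field D)).
Proof.
move=> sD D1; set K := quadratic_field D.
(* The factor 2 accounts for integers of the field with half-integral coordinates. *)
pose M : nat := (D`! * 2)%N.
have M0 : (0 < M)%N by rewrite muln_gt0 fact_gt0.
have MR : M%:R != 0 :> rat by rewrite pnatr_eq0 -lt0n.
pose lat (S : {set 'I_M * 'I_M}) : set algC := [set z | exists2 ij, ij \in S &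
  exists u v : int,
    z = qel D (ij.1%:R / M%:R + u%:~R) (ij.2%:R / M%:R + v%:~R)].
apply: (@sub_finite_set _ _
  [set ideal_class K (lat S) | S in [set: {set 'I_M * 'I_M}]]); last first.
  exact/finite_image/finite_finset.
move=> _ [I fI <-].
have [beta [Ib b0 bI]] := fractional_ideal_reduced sD D1 fI.
have [IK _ IA IM _] := fI.
pose J : set algC := [set beta^-1 * y | y in I].
have bK : K beta^-1 by apply: quadratic_fieldV => //; apply: IK.
have b0' : beta^-1 != 0 by rewrite invr_neq0.
(* J = I / beta contains the integers of the field, so it is a union of cosets of Z[sqrt D]; S
   collects their residues. *)
exists (finset (fun ij : 'I_M * 'I_M =>
  `[< J (qel D (ij.1%:R / M%:R) (ij.2%:R / M%:R)) >])) => //.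
rewrite -(ideal_class_scale I sD D1 bK b0') -/J; congr ideal_class.
have JA x y : J x -> J y -> J (x + y).
  move=> [x' Ix <-] [y' Iy <-].
  by exists (x' + y'); [exact: IA | rewrite mulrDr].
have JO x : OK D x -> J x.
  by move=> Ox; exists (x * beta); [exact: IM | rewrite mulrCA mulVf ?mulr1].
apply/seteqP; split=> z.
  move=> [ij]; rewrite finset.inE => /asboolP Jij [u [v ->]].
  by rewrite -qelD; apply: JA => //; apply/JO/qel_int_OK.
move=> Jz; have [y Iy zE] := Jz.
have [p [q E]] : K z by rewrite -zE; apply: quadratic_fieldM => //; exact: IK.
rewrite -/(qel D p q) in E.
have OE : OK D (qel D (D`!%:R * p) (D`!%:R * q)).
  have -> : qel D (D`!%:R * p) (D`!%:R * q) = D`!%:R * (y / beta).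
    rewrite (mulrC y) zE E -(ratr_nat algC D`!) -(qel0r D) qelM.
    by congr (qel D _ _); ring.
  exact: bI.
have [_ A] := OE; have [pZ qZ _] := qel_Aint sD D1 A.
have dec (r : rat) : (D`!%:R * r) *+ 2 \in Num.int ->
    exists i : 'I_M, exists u : int, r = i%:R / M%:R + u%:~R.
  move=> /intrP[m mE].
  have MZ : M%:Z != 0 by rewrite -lt0n.
  have lt : (`|(m %% M%:Z)%Z| < M)%N.
    by rewrite -ltz_nat gez0_abs ?modz_ge0// ltz_pmod// ltz_nat.
  exists (Ordinal lt), (m %/ M%:Z)%Z => /=.
  have -> : r = m%:~R / M%:R.
    by rewrite -mE /M natrM; field; rewrite pnatr_eq0 -lt0n fact_gt0.
  rewrite {1}(divz_eq m M%:Z) natr_absz ger0_norm ?modz_ge0//.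
  by rewrite intrD intrM; field.
have [i [u pE]] := dec _ pZ; have [j [v qE]] := dec _ qZ.
exists (i, j); last by exists u, v; rewrite E pE qE.
rewrite finset.inE; apply/asboolP => /=.
have -> : qel D (i%:R / M%:R) (j%:R / M%:R) = z + qel D (- u)%:~R (- v)%:~R.
  by rewrite E pE qE qelD; congr (qel D _ _); rewrite intrN addrK.
by apply: JA => //; apply/JO/qel_int_OK.
Qed.

(** * A non-principal ideal *)

Definition ideal2 (D : nat) (g1 g2 : algC) : set algC :=
  [set g1 * x.1 + g2 * x.2 | x in [set x | OK D x.1 /\ OK D x.2]].

Lemma ideal2_OK D g1 g2 : OK D g1 -> OK D g2 -> ideal2 D g1 g2 `<=` OK D.
Proof.
by move=> O1 O2 _ [[x y] /= [Ox Oy] <-]; apply: OK_add; apply: OK_mul.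
Qed.

Lemma ideal2_fractional D g1 g2 : OK D g1 -> OK D g2 -> g1 != 0 ->
  fractional_ideal (quadratic_field D) (ideal2 D g1 g2).
Proof.
move=> O1 O2 g0.
have IO := ideal2_OK O1 O2.
split.
- by move=> z /IO[].
- exists g1 => //; exists (1, 0); last by rewrite /= mulr1 mulr0 addr0.
  by split; [exact: (OK_nat D 1) | exact: (OK_nat D 0)].
- move=> _ _ [[x y] /= [Ox Oy] <-] [[x' y'] /= [Ox' Oy'] <-].
  exists (x + x', y + y'); last by rewrite /=; ring.
  by split; apply: OK_add.
- move=> a _ Oa [[x y] /= [Ox Oy] <-].
  exists (a * x, a * y); last by rewrite /=; ring.
  by split; apply: OK_mul.
- exists 1; split; [exact: (OK_nat D 1) | exact: oner_neq0 |].
  by move=> z /IO; rewrite mul1r.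
Qed.

(** For g of norm p m, N(p x + g y) = p^2 N(x) + p Tr(x conj(g y)) + p m N(y); in the proof t is the
    trace. *)
Lemma ideal2_norm D (p : nat) c d a b m : squarefree D -> (1 < D)%N ->
  (0 < p)%N -> OK D (qel D c d) -> qnorm D c d = p%:R * m -> m \in Num.int ->
  ideal2 D p%:R (qel D c d) (qel D a b) ->
  exists l : int, qnorm D a b = p%:R * l%:~R.
Proof.
move=> sD D1 p0 Og gN mZ [[x y] /= [Ox Oy] E].
have [[x1 [x2 xE]] Ax] := Ox; have [[y1 [y2 yE]] Ay] := Oy.
rewrite -/(qel D _ _) in xE yE; rewrite xE in Ax Ox; rewrite yE in Ay Oy.
have [_ Agy] := OK_mul Og Oy.
rewrite qelM in Agy; move: E; rewrite xE yE qelM.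
have -> : p%:R = qel D p%:R 0 by rewrite qel0r ratr_nat.
have := qnormM D c d y1 y2.
set r1 := _ + _ in Agy *; set r2 := _ + _ in Agy *.
rewrite qelM qelD gN => rN /(qel_inj sD D1)[<- <-].
have : qel D x1 x2 * qel D r1 (- r2) \in Aint.
  by apply: rpredM => //; apply: qel_conj_Aint.
rewrite qelM => /(qel_Aint sD D1)[/intrP[t tE] _ _].
have [_ _ /intrP[k1 Nx]] := qel_Aint sD D1 Ax.
have [_ _ /intrP[k2 Ny]] := qel_Aint sD D1 Ay.
case/intrP: mZ rN => k3 -> rN.
exists (p%:Z * k1 + t + k3 * k2).
move: rN; rewrite !intrD !intrM -tE -Nx -Ny => rN.
rewrite [RHS]mulrDr [X in _ = _ + X]mulrA -rN; clearbody r1 r2.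
by rewrite /qnorm; ring.
Qed.

(** For a generator x, N(x) = p l and p = x u give l N(u) = p. If |l| = 1, then 2x has norm +-4p; if
    |l| = p, then u is a unit and p divides c + sqrt D. *)
Lemma ideal2_not_principal D (p : nat) c x : squarefree D -> (1 < D)%N ->
  prime p -> odd p -> (p%:Z %| c ^+ 2 - D%:Z)%Z ->
  (forall u v : int, `|(u ^+ 2 - D%:Z * v ^+ 2)%R|%N <> (4 * p)%N) ->
  ideal2 D p%:R (qel D c%:~R 1%:~R) <> [set x * y | y in OK D].
Proof.
move=> sD D1 pp op pc noN IE; set g := qel D _ _ in IE *.
have Og : OK D g by apply: qel_int_OK.
have p0 := prime_gt0 pp.
have pR : p%:R != 0 :> rat by rewrite pnatr_eq0 -lt0n.
have Ix : ideal2 D p%:R g x.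
  by rewrite IE; exists 1; [exact: (OK_nat D 1) | rewrite mulr1].
have [[a [b xE]] Ax] := ideal2_OK (OK_nat D p) Og Ix.
rewrite -/(qel D a b) in xE.
have [l lE] : exists l : int, qnorm D a b = p%:R * l%:~R.
  case/dvdzP: pc => m mE.
  apply: (@ideal2_norm D p c%:~R 1%:~R a b m%:~R) => //; last by rewrite -xE.
    rewrite /qnorm expr1n mulr1 -[p%:R]/(p%:Z%:~R) -intrM mulrC -mE.
    by rewrite rmorphB rmorphXn.
have [u Ou pE] : [set x * y | y in OK D] p%:R.
  rewrite -IE; exists (1, 0); last by rewrite /= mulr1 mulr0 addr0.
  by split; [exact: (OK_nat D 1) | exact: (OK_nat D 0)].
have [v Ov gE] : [set x * y | y in OK D] g.
  rewrite -IE; exists (0, 1); last by rewrite /= mulr1 mulr0 add0r.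
  by split; [exact: (OK_nat D 0) | exact: (OK_nat D 1)].
have [[u1 [u2 uE]] Au] := Ou; rewrite -/(qel D _ _) in uE.
rewrite uE in Au.
have [_ _ /intrP[k kE]] := qel_Aint sD D1 Au.
have lk : l * k = p%:Z.
  apply: (@intr_inj rat); rewrite intrM -kE.
  move: pE; rewrite xE uE qelM.
  have -> : p%:R = qel D p%:R 0 by rewrite qel0r ratr_nat.
  move=> /(qel_inj sD D1)[E1 E2].
  have := qnormM D a b u1 u2; rewrite E1 E2 lE /qnorm expr0n mulr0 subr0.
  by rewrite -mulrA expr2 => /(mulfI pR) <-.
have lkn : (`|l| * `|k|)%N = p by rewrite -abszM lk.
have [l1|lp] : (`|l| = 1)%N \/ (`|l| = p)%N.
- have : (`|l| %| p)%N by rewrite -lkn dvdn_mulr.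
  by case/primeP: pp => _ H /H /orP[] /eqP; [left | right].
- rewrite xE in Ax.
  have [/intrP[A AE] /intrP[B BE] _] := qel_Aint sD D1 Ax.
  apply: (noN A B).
  have -> : A ^+ 2 - D%:Z * B ^+ 2 = 4 * (p%:Z * l).
    apply: (@intr_inj rat); rewrite rmorphB !expr2 !rmorphM /= -lE -AE -BE.
    by rewrite /qnorm; ring.
  by rewrite !abszM l1 muln1.
have k1 : `|k|%N = 1%N by move: lkn; rewrite lp; nia.
(* Since N(u) = k = +-1, the inverse of u is k times its conjugate. *)
have vE : g = p%:R * (qel D (k%:~R * u1) (k%:~R * - u2) * v).
  have -> : qel D (k%:~R * u1) (k%:~R * - u2) = k%:~R * qel D u1 (- u2).
    have -> : k%:~R = qel D k%:~R 0 by rewrite qel0r ratr_int.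
    by rewrite qelM; congr (qel D _ _); ring.
  rewrite -pE -gE uE.
  transitivity (x * k%:~R * (qel D u1 u2 * qel D u1 (- u2)) * v); last by ring.
  rewrite qelMconj kE ratr_int -(mulrA x) -intrM.
  by rewrite (_ : k * k = 1) ?mulr1//; lia.
have Okv : qel D (c%:~R / p%:R) p%:R^-1 \in Aint.
  have -> : qel D (c%:~R / p%:R) p%:R^-1 = qel D (k%:~R * u1) (k%:~R * - u2) * v.
    apply: (@mulfI _ (p%:R)); first by rewrite pnatr_eq0 -lt0n.
    rewrite -vE; have -> : p%:R = qel D p%:R 0 by rewrite qel0r ratr_nat.
    by rewrite qelM /g; congr (qel D _ _); field.
  apply: rpredM; last by case: Ov.
  have -> : qel D (k%:~R * u1) (k%:~R * - u2) = k%:~R * qel D u1 (- u2).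
    have -> : k%:~R = qel D k%:~R 0 by rewrite qel0r ratr_int.
    by rewrite qelM; congr (qel D _ _); ring.
  by apply: rpredM; [exact: Aint_int | exact: qel_conj_Aint].
have [_ /intrP[t tE] _] := qel_Aint sD D1 Okv.
(* Integrality of (c + sqrt D) / p makes twice its second coordinate, 2 / p, an integer. *)
have : (p %| 2)%N.
  apply/dvdnP; exists `|t|%N.
  have : 2 = t * p%:Z; last by lia.
  by apply: (@intr_inj rat); rewrite intrM -tE; field.
by rewrite dvdn_prime2// => /eqP p2; rewrite p2 in op.
Qed.

(** * Two distinct ideal classes *)

Local Open Scope nat_scope.

Theorem proposition1p4 (b s k : nat) :
  0 < b -> 0 < s -> 0 < k ->
  squarefree (D_ b s k) ->
  ~~ prime (4 * b * s + 1) ->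
  1 < h (D_ b s k).
Proof.
move=> b0 s0 k0 sD npr; set D := D_ b s k in sD *.
set n := (4 * b * s + 1)%N in npr.
have n1 : (1 < n)%N by rewrite /n; nia.
have D1 : (1 < D)%N.
  have nk : (0 < n ^ k)%N by rewrite expn_gt0 ltnW.
  rewrite /D /D_ -/n; nia.
pose K := quadratic_field D; pose p := pdiv n; pose c := (b * n ^ k + s)%N.
have pp : prime p := pdiv_prime n1.
have op : odd p by apply: dvdn_odd (pdiv_dvd n) _; rewrite /n; lia.
have pc : (p%:Z %| (c%:Z ^+ 2 - D%:Z)%R)%Z.
  have -> : (c%:Z ^+ 2 - D%:Z = - (n ^ k)%N%:Z)%R.
    by rewrite /D /D_ -/n -/c; lia.
  by rewrite dvdzE abszN /= dvdn_exp// pdiv_dvd.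
pose I := ideal2 D p%:R%R (qel D c%:Z%:~R 1%:~R)%R.
have fI : fractional_ideal K I.
  apply: ideal2_fractional; [exact: OK_nat | exact: qel_int_OK |].
  by rewrite pnatr_eq0 -lt0n prime_gt0.
(* I lies in its own class, so equal classes would make I principal. *)
have clN : ideal_class K I <> ideal_class K (OK D).
  move=> E; have : ideal_class K I I.
    exists 1%R; first by split; [exact: (OK_nat D 1).1 | exact: oner_neq0].
    apply/seteqP; split=> [_ [y Iy <-]|y Iy]; [|exists y => //];
      by rewrite mul1r.
  rewrite E => -[x _ xE].
  apply: (@ideal2_not_principal D p c%:Z x sD D1 pp op pc).
    by move=> u v; apply: norm_neq_pdiv.
  exact/esym.
have fin := finite_class_group sD D1.
rewrite /h /class_number.
rewrite -/K; pose A := [fset ideal_class K I; ideal_class K (OK D)]%fset.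
have -> : 2%N = #|` A| by rewrite cardfs2 (introN eqP clN).
apply/fsubset_leq_card/fsubsetP => c' /fset2P[] ->; rewrite in_fset_set// inE.
  by exists I.
by exists (OK D) => //; exact: OK_fractional_ideal.
Qed.
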